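(* Let $\mathcal{G}=(V,D,B)$ be a mixed graph, and let $C_1,\dots,C_l$ be the vertex sets of the connected components of its bidirected part $\mathcal{G}_\leftrightarrow=(V,\emptyset,B)$. Then $\tau(\mathcal{G})\le\max_{j=1,\dots,l}|\mathrm{Pa}(C_j)|$; that is, if $n\ge\max_j|\mathrm{Pa}(C_j)|$ then $\hat\ell(\mathcal{G}\mid S_{0,n})<\infty$ almost surely.
   Context: A mixed graph is a triple $\mathcal{G}=(V,D,B)$ with $V=\{1,\dots,p\}$, $D\subseteq V\times V$ directed edges $i\to j$ (no self-loops), and $B$ a set of 2-element subsets of $V$ (bidirected edges). $\mathrm{pa}(j)=\{k: k\to j\in D\}$ and $\mathrm{Pa}(A)=A\cup\bigcup_{i\in A}\mathrm{pa}(i)$. $\mathbb{R}^D_{\mathrm{reg}}$ is the set of real $p\times p$ matrices $\Lambda$ with $\lambda_{ij}=0$ whenever $i\to j\notin D$ and $I-\Lambda$ invertible; $PD(B)$ is the set of positive definite $\Omega$ with $\omega_{ij}=0$ for $i\neq j$, $\{i,j\}\notin B$; $PD(\mathcal{G})=\{(I-\Lambda)^{-T}\Omega(I-\Lambda)^{-1}:\Lambda\in\mathbb{R}^D_{\mathrm{reg}},\Omega\in PD(B)\}$. For an i.i.d. sample $X^{(1)},\dots,X^{(n)}$ from an absolutely continuous distribution on $\mathbb{R}^p$, $S_{0,n}=\frac1n\sum_s X^{(s)}(X^{(s)})^T$; $\ell(\Sigma\mid S)=-\log\det\Sigma-\mathrm{trace}(\Sigma^{-1}S)$; $\hat\ell(\mathcal{G}\mid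 S)=\sup_{\Sigma\in PD(\mathcal{G})}\ell(\Sigma\mid S)$; $\tau(\mathcal{G})=\min\{N\in\mathbb{N}:\hat\ell(\mathcal{G}\mid S_{0,n})<\infty\text{ a.s. for all }n\ge N\}$. *)

(* Defs.v *)
From HB Require Import structures.
From mathcomp Require Import all_boot all_order all_algebra.
From mathcomp Require Import all_classical all_reals all_analysis.
Set Implicit Arguments. Unset Strict Implicit. Unset Printing Implicit Defensive.
Import Order.TTheory GRing.Theory Num.Theory.
Local Open Scope classical_set_scope.
Local Open Scope ring_scope.

(* directed edges: D i j  means  i -> j ;  bidirected edges: B i j (symmetric) *)
Definition mixed_graph (p : nat) (D B : rel 'I_p) : Prop :=
  irreflexive D /\ irreflexive B /\ symmetric B.

Definition pa (p : nat) (D : rel 'I_p) (j : 'I_p) : {set 'I_p} :=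
  [set k | D k j].

Definition Pa (p : nat) (D : rel 'I_p) (A : {set 'I_p}) : {set 'I_p} :=
  A :|: \bigcup_(i in A) pa D i.

Definition bcomp (p : nat) (B : rel 'I_p) (v : 'I_p) : {set 'I_p} :=
  [set w | connect B v w].

Definition posdef (R : realFieldType) (p : nat) (M : 'M[R]_p) : Prop :=
  M^T = M /\ forall x : 'cV[R]_p, x != 0 -> 0 < (x^T *m M *m x) 0 0.

Definition RDreg (R : realFieldType) (p : nat) (D : rel 'I_p) (L : 'M[R]_p) : Prop :=
  (forall i j, ~~ D i j -> L i j = 0) /\ (1%:M - L) \in unitmx.

Definition PDB (R : realFieldType) (p : nat) (B : rel 'I_p) (W : 'M[R]_p) : Prop :=
  posdef W /\ forall i j, i != j -> ~~ B i j -> W i j = 0.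

Definition PDG (R : realFieldType) (p : nat) (D B : rel 'I_p) (S : 'M[R]_p) : Prop :=
  exists L W, RDreg D L /\ PDB B W /\
    S = (invmx (1%:M - L))^T *m W *m invmx (1%:M - L).

Definition loglik (R : realType) (p : nat) (Sig S : 'M[R]_p) : R :=
  - ln (\det Sig) - \tr (invmx Sig *m S).

(* hat l(G | S) < oo, i.e. the supremum over PD(G) is finite
   (PD(G) is nonempty, so this means bounded above) *)
Definition lhat_finite (R : realType) (p : nat) (D B : rel 'I_p) (S : 'M[R]_p) : Prop :=
  exists M : R, forall Sig, PDG D B Sig -> loglik Sig S <= M.

Definition sample_cov (R : realFieldType) (p n : nat) (x : 'I_n -> 'cV[R]_p) : 'M[R]_p :=
  n%:R^-1 *: \sum_(s < n) (x s *m (x s)^T).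

Definition coord_sets (R : realType) (p : nat) : set (set 'cV[R]_p) :=
  [set A | exists k : 'I_p, exists2 Y : set R, measurable Y &
           A = (fun v : 'cV[R]_p => v k 0) @^-1` Y].
Definition borel_vec (R : realType) (p : nat) (A : set 'cV[R]_p) : Prop :=
  <<s @coord_sets R p >> A.

Definition box (R : realType) (p : nat) (a b : 'cV[R]_p) : set 'cV[R]_p :=
  [set x | forall k, a k 0 <= x k 0 <= b k 0].
Definition box_vol (R : realType) (p : nat) (a b : 'cV[R]_p) : R :=
  \prod_(k < p) (b k 0 - a k 0).
Definition leb_null (R : realType) (p : nat) (A : set 'cV[R]_p) : Prop :=
  forall eps : R, 0 < eps ->
    exists a b : nat -> 'cV[R]_p,
      [/\ forall m k, a m k 0 <= b m k 0,
          A `<=` \bigcup_m box (a m) (b m) &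
          (\sum_(0 <= m <oo) (box_vol (a m) (b m))%:E < eps%:E)%E].

Section RV.
Context (d : measure_display) (T : measurableType d) (R : realType)
        (P : probability T R) (p : nat).

Definition random_vec (X : T -> 'cV[R]_p) : Prop :=
  forall k : 'I_p, measurable_fun setT (fun w => X w k 0).

Definition abs_cont (X : T -> 'cV[R]_p) : Prop :=
  forall A, borel_vec A -> leb_null A -> P (X @^-1` A) = 0%E.

Definition same_law (X Y : T -> 'cV[R]_p) : Prop :=
  forall A, borel_vec A -> P (X @^-1` A) = P (Y @^-1` A).

Definition mutually_indep (n : nat) (X : 'I_n -> T -> 'cV[R]_p) : Prop :=
  forall A : 'I_n -> set 'cV[R]_p, (forall s, borel_vec (A s)) ->
    P (\bigcap_(s in [set: 'I_n]) (X s @^-1` A s)) =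
    (\prod_(s < n) P (X s @^-1` A s))%E.

Definition iid_ac_sample (n : nat) (X : 'I_n -> T -> 'cV[R]_p) : Prop :=
  (forall s, random_vec (X s)) /\ (forall s, abs_cont (X s)) /\
  (forall s t, same_law (X s) (X t)) /\ mutually_indep X.
End RV.

(* Main.v *)
(* The precision matrix K = Sig^-1 factors as A N A^T with A = 1 - L and
   N = W^-1, and N is block diagonal along the bidirected components, so
   tr (K S) splits into one quadratic-form sum per component C, involving only
   the coordinates in Pa(C). If the data restricted to every Pa(C) span the whole
   coordinate space, then tr K <= c tr (K S) with c depending on the data only,
   and since |K i j| <= tr K the log-likelihood is at most
   ln (p! (tr K + 1)^p) - tr K / c, which is bounded.

   The spanning condition holds almost surely: expanding a leading minor of the
   data matrix along its last column, the new sample has to avoid the hyperplane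
   orthogonal to the cofactor vector. That vector depends on the other samples
   only and is nonzero by induction, so Fubini reduces the claim to the fact
   that hyperplanes are Lebesgue null. *)

Require Import Defs.
From HB Require Import structures.
From mathcomp Require Import all_boot all_order all_algebra perm.
From mathcomp Require Import all_classical all_reals all_analysis.
From mathcomp Require Import measurable_realfun ring lra.
Set Implicit Arguments. Unset Strict Implicit. Unset Printing Implicit Defensive.
Import Order.TTheory GRing.Theory Num.Theory.
Local Open Scope classical_set_scope.
Local Open Scope ring_scope.

(** * Quadratic forms, entry bounds and block-diagonal matrices *)

Section QuadraticForms.
Variables (R : realFieldType) (p : nat).
Implicit Types (N M A : 'M[R]_p) (u v x : 'cV[R]_p).

Definition quad N v : R := (v^T *m N *m v) 0 0.

Lemma quad_sumE N v : quad N v = \sum_i \sum_j v i 0 * N i j * v j 0.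
Proof.
rewrite /quad mxE exchange_big /=; apply: eq_bigr => j _.
by rewrite mxE mulr_suml; apply: eq_bigr => i _; rewrite mxE.
Qed.

Lemma quad_mul N A v : quad (A *m N *m A^T) v = quad N (A^T *m v).
Proof. by rewrite /quad trmx_mul trmxK !mulmxA. Qed.

Lemma quad_delta N k : quad N (delta_mx k 0) = N k k.
Proof.
rewrite quad_sumE (bigD1 k)//= (bigD1 k)//= !mxE !eqxx mul1r mulr1.
rewrite big1 ?addr0 => [|j jk]; last by rewrite !mxE (negbTE jk) mulr0.
rewrite big1 ?addr0 // => i ik.
by rewrite big1 // => j _; rewrite !mxE (negbTE ik) !mul0r.
Qed.

Lemma quadZ N a v : quad N (a *: v) = a ^+ 2 * quad N v.
Proof.
rewrite !quad_sumE mulr_sumr; apply: eq_bigr => i _; rewrite mulr_sumr.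
by apply: eq_bigr => j _; rewrite !mxE; ring.
Qed.

Lemma quadD N u v : quad N (u + v) =
  quad N u + quad N v + ((u^T *m N *m v) 0 0 + (v^T *m N *m u) 0 0).
Proof. by rewrite /quad [(u + v)^T]linearD/= !mulmxDl !mulmxDr !mxE; ring. Qed.

Lemma quadN N v : quad N (- v) = quad N v.
Proof. by rewrite -scaleN1r quadZ sqrrN expr1n mul1r. Qed.

(** Parallelogram law: the values at u + v and u - v add up to the right-hand side, and the value at
    u - v is nonnegative. *)
Lemma quadD_le N u v : (forall x, 0 <= quad N x) ->
  quad N (u + v) <= 2 * (quad N u + quad N v).
Proof.
move=> /(_ (u - v)); rewrite !quadD quadN [(- _)^T]linearN/= mulmxN !mulNmx !mxE.
lra.
Qed.

Lemma quad_sum_le N n (x : 'I_n -> 'cV[R]_p) : (forall x, 0 <= quad N x) ->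
  quad N (\sum_(s < n) x s) <= 2 ^+ n * \sum_(s < n) quad N (x s).
Proof.
move=> N0; elim: n x => [|n IH] x.
  by rewrite !big_ord0 mulr0 /quad mulmx0 mxE.
rewrite !big_ord_recr/=; apply: le_trans (quadD_le _ _ N0) _.
have := IH (fun i => x (widen_ord (leqnSn n) i)).
set a := quad _ (\sum_i _); set b := \sum_i _ => ab.
have c0 := N0 (x ord_max).
have p1 : 1 <= 2 ^+ n :> R by rewrite exprn_ege1 // ler1n.
rewrite exprS; nra.
Qed.

(** Nonnegativity at e_i + e_j and e_i - e_j gives 2 |M i j| <= M i i + M j j, and each diagonal
    entry is at most the trace because the others are nonnegative. *)
Lemma entry_le_trace M i j : M^T = M -> (forall x, 0 <= quad M x) ->
  `|M i j| <= \tr M.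
Proof.
move=> sM M0.
have d0 k : 0 <= M k k by rewrite -quad_delta.
have dt k : M k k <= \tr M.
  by rewrite /mxtrace (bigD1 k)//= lerDl sumr_ge0.
have sy : M j i = M i j by rewrite -[in LHS]sM mxE.
have b k l :
    ((delta_mx k 0 : 'cV[R]_p)^T *m M *m (delta_mx l 0 : 'cV[R]_p)) 0 0 = M k l.
  by rewrite trmx_delta -rowE -colE !mxE.
have nE (Z : 'M[R]_1) : (- Z) 0 0 = - Z 0 0 by rewrite mxE.
have := M0 (delta_mx i 0 - delta_mx j 0); have := M0 (delta_mx i 0 + delta_mx j 0).
rewrite !quadD quadN [(- _)^T]linearN/= mulmxN !mulNmx !quad_delta.
rewrite !nE !b sy.
have := dt i; have := dt j; rewrite ler_norml; lra.
Qed.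

Lemma det_entries_le M (t : R) : (forall i j, `|M i j| <= t) ->
  `|\det M| <= (p`!)%:R * t ^+ p.
Proof.
move=> Mt; rewrite /determinant; apply: le_trans (ler_norm_sum _ _ _) _.
apply: (@le_trans _ _ (\sum_(s : 'S_p) t ^+ p)).
  apply: ler_sum => s _; rewrite normrM normrX normrN1 expr1n mul1r normr_prod.
  rewrite -[X in t ^+ X]card_ord -prodr_const; apply: ler_prod => i _.
  by rewrite normr_ge0/=.
by rewrite sumr_const mulr_natl card_Sn.
Qed.

Lemma posdef_unitmx N : posdef N -> N \in unitmx.
Proof.
move=> [sN N0]; rewrite -row_free_unit -kermx_eq0; apply/eqP/row_matrixP => i.
rewrite row0; apply/eqP; apply: contraT => r0.
have rN : row i (kermx N) *m N = 0 by rewrite -row_mul mulmx_ker row0.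
have := N0 (row i (kermx N))^T; rewrite trmxK rN mul0mx mxE ltxx.
by apply; rewrite -(inj_eq (@trmx_inj _ _ _)) trmxK trmx0.
Qed.

Lemma posdef_quad_ge0 N v : posdef N -> 0 <= quad N v.
Proof.
move=> [_ N0]; have [->|/N0/ltW//] := eqVneq v 0.
by rewrite /quad mulmx0 mxE.
Qed.

Lemma quad_invmx N v : posdef N -> quad (invmx N) v = quad N (invmx N *m v).
Proof.
move=> pN; have uN := posdef_unitmx pN; case: pN => sN _.
by rewrite /quad trmx_mul trmx_inv sN -!mulmxA (mulKVmx uN).
Qed.

(** Commuting with all these diagonal projections is the same as being block diagonal for the
    classes of [f]. *)
Definition label_proj (I : eqType) (f : 'I_p -> I) r : 'M[R]_p :=
  \matrix_(i, j) ((i == j) && (f i == r))%:R.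

Lemma label_proj_mulr (I : eqType) (f : 'I_p -> I) r N i j :
  (N *m label_proj f r) i j = N i j * (f j == r)%:R.
Proof.
rewrite mxE (bigD1 j)//= mxE eqxx/= big1 ?addr0 // => k kj.
by rewrite mxE (negbTE kj) mulr0.
Qed.

Lemma label_proj_mull m (I : eqType) (f : 'I_p -> I) r (N : 'M[R]_(p, m)) i j :
  (label_proj f r *m N) i j = (f i == r)%:R * N i j.
Proof.
rewrite mxE (bigD1 i)//= mxE eqxx/= big1 ?addr0 // => k ki.
by rewrite mxE eq_sym (negbTE ki) mul0r.
Qed.

(** A matrix that commutes with a projection has an inverse that commutes with it too; the
    projection onto the class of j isolates the entry (i, j). *)
Lemma invmx_block (I : eqType) (f : 'I_p -> I) N : N \in unitmx ->
  (forall i j, f i != f j -> N i j = 0) ->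
  forall i j, f i != f j -> invmx N i j = 0.
Proof.
move=> uN N0 i j fij; set E := label_proj f (f j).
have EN : E *m N = N *m E.
  apply/matrixP => k l; rewrite label_proj_mull label_proj_mulr.
  have [e|ne] := eqVneq (f k) (f l); first by rewrite e mulrC.
  by rewrite N0 // mulr0 mul0r.
have EV : E *m invmx N = invmx N *m E.
  by rewrite -[in LHS](mulKmx uN E) -!mulmxA (mulmxA N) -EN mulmxK.
move/matrixP: EV => /(_ i j).
by rewrite label_proj_mull label_proj_mulr (negbTE fij) mul0r eqxx mulr1.
Qed.

Lemma quad_label_split (I : finType) (f : 'I_p -> I) N v :
  (forall i j, f i != f j -> N i j = 0) ->
  quad N v = \sum_r quad N (label_proj f r *m v).
Proof.
move=> N0; rewrite quad_sumE.
under [RHS]eq_bigr do rewrite quad_sumE.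
rewrite [RHS]exchange_big/=; apply: eq_bigr => i _.
rewrite [RHS]exchange_big/=; apply: eq_bigr => j _.
rewrite (bigD1 (f i))//= !label_proj_mull eqxx mul1r big1 => [|r ri]; last first.
  by rewrite label_proj_mull eq_sym (negbTE ri) !mul0r.
rewrite addr0 eq_sym.
have [_|ne] := eqVneq (f i) (f j); first by rewrite mul1r.
by rewrite N0 // mulr0 !mul0r.
Qed.

End QuadraticForms.

(** * Deterministic bound on the log-likelihood *)

Lemma ln_pow_le_linear (R : realType) (p : nat) (c : R) : 0 < c ->
  exists M : R, forall t, 0 <= t -> ln ((p`!)%:R * (t + 1) ^+ p) <= t / c + M.
Proof.
(* Bounding ln at (t + 1) / a costs slope p / a = p / (c (p + 1)), which is at most 1 / c; the
   successor keeps a positive for p = 0. *)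
move=> c0; pose a := c * p.+1%:R; have a0 : 0 < a by rewrite mulr_gt0.
exists (ln (p`!)%:R + (ln a + a^-1) *+ p) => t t0.
have t1 : 0 < t + 1 by lra.
have f0 : 0 < (p`!)%:R :> R by rewrite ltr0n fact_gt0.
rewrite lnM ?posrE ?exprn_gt0// lnXn// addrCA lerD2l.
have h : ln (t + 1) <= (t + 1) / a + ln a.
  rewrite -lerBlDr -ln_div ?posrE//; apply/ltW/ln_sublinear.
  by rewrite divr_gt0.
apply: (@le_trans _ _ (((t + 1) / a + ln a) *+ p)); first by rewrite lerMn2r h orbT.
rewrite mulrDl mul1r -addrA (addrC a^-1) mulrnDl lerD2r -mulr_natr /a.
rewrite invfM mulrA -mulrA ler_piMr ?divr_ge0 ?(ltW c0)//.
by rewrite mulrC ler_pdivrMr // mul1r ler_nat.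
Qed.

Section BoundedLikelihood.
Variables (R : realType) (p : nat) (D B : rel 'I_p).

(* The rows indexed by U of the data matrix (x s u) are linearly independent,
   expressed by a right inverse. *)
Definition rows_independent n (x : 'I_n -> 'cV[R]_p) (U : {set 'I_p}) : Prop :=
  forall k, k \in U -> exists c : 'I_n -> R,
    forall u, u \in U -> \sum_s c s * x s u 0 = (u == k)%:R.

(** Inverting removes the inverse of 1 - L: column j of A = 1 - L is supported on j and its parents,
    which is how [Pa] enters. *)
Lemma PDG_inv (Sig : 'M[R]_p) : PDG D B Sig ->
  exists A W : 'M[R]_p, [/\ forall i j, i != j -> ~~ D i j -> A i j = 0,
    PDB B W & Sig \in unitmx /\ invmx Sig = A *m invmx W *m A^T].
Proof.
move=> [L [W [[L0 uA] [pW ->]]]]; exists (1%:M - L), W; split=> //.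
  by move=> i j ij Dij; rewrite !mxE (negbTE ij) L0 // subr0.
set A := 1%:M - L in uA *.
have uW : W \in unitmx by case: pW => /posdef_unitmx.
have uS : (invmx A)^T *m W *m invmx A \in unitmx.
  by rewrite !unitmx_mul unitmx_tr unitmx_inv uA uW.
split=> //; rewrite -[LHS]mul1mx; apply: (canLR (mulmxK uS)).
rewrite !mulmxA -(mulmxA (A *m _)) -trmx_mul mulVmx // trmx1 mulmx1.
by rewrite -(mulmxA A) mulVmx // mulmx1 mulmxV.
Qed.

(* A component is labelled by its root, so the labels that are not roots
   have an empty class. *)
Lemma root_class_bcomp r : symmetric B ->
  r = fingraph.root B r -> [set i | fingraph.root B i == r]%SET = bcomp B r.
Proof.
move=> sB rr; apply/setP => i; rewrite !inE [in LHS]rr eq_sym.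
by rewrite root_connect //; apply: sym_connect_sym.
Qed.

Lemma trace_le_trace_mul_sample_cov n (x : 'I_n -> 'cV[R]_p) :
  symmetric B -> (0 < n)%N ->
  (forall v, rows_independent x (Pa D (bcomp B v))) ->
  exists2 c : R, 0 < c & forall Sig, PDG D B Sig ->
    \tr (invmx Sig) <= c * \tr (invmx Sig *m sample_cov x).
Proof.
move=> sB n0 xU; pose C r := [set i | fingraph.root B i == r]%SET.
(* Both membership conditions sit under the existential, with zero coefficients as default, so that
   [choice] can run over all pairs (r, k). *)
have rC r k : exists c : 'I_n -> R, forall u, u \in Pa D (C r) ->
    k \in Pa D (C r) -> \sum_s c s * x s u 0 = (u == k)%:R.
  have [kC|_] := boolP (k \in _); last by exists (fun=> 0).
  have [e|ne] := eqVneq r (fingraph.root B r).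
    move: kC; rewrite /C root_class_bcomp // => kC.
    by have [c h] := xU r k kC; exists c => u uC _; apply: h.
  suff C0 : C r = finset.set0.
    exists (fun=> 0) => u; rewrite C0 /Pa finset.set0U big_set0 inE//.
  apply/setP => i; rewrite !inE; apply: contra_neqF ne => /eqP <-.
  by rewrite root_root //; apply: sym_connect_sym.
have [c hc] : {c : 'I_p -> 'I_p -> 'I_n -> R | forall r k u, u \in Pa D (C r) ->
    k \in Pa D (C r) -> \sum_s c r k s * x s u 0 = (u == k)%:R}.
  have /choice[c h] : forall rk : 'I_p * 'I_p, exists c : 'I_n -> R,
      forall u, u \in Pa D (C rk.1) ->
      rk.2 \in Pa D (C rk.1) -> \sum_s c s * x s u 0 = (u == rk.2)%:R.
    by case=> r k; exact: rC.
  by exists (fun r k => c (r, k)) => r k; exact: (h (r, k)).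
pose m := \sum_r \sum_k \sum_s c r k s ^+ 2.
have cm r k s : c r k s ^+ 2 <= m.
  have s0 r' k' : 0 <= \sum_s c r' k' s ^+ 2.
    by apply: sumr_ge0 => ? _; rewrite sqr_ge0.
  rewrite /m (bigD1 r)//= (bigD1 k)//= (bigD1 s)//= -!addrA lerDl.
  rewrite !addr_ge0 //; first by apply: sumr_ge0 => ? _; rewrite sqr_ge0.
    by apply: sumr_ge0.
  by do 2! (apply: sumr_ge0 => ? _).
have m0 : 0 <= m.
  by do 3! (apply: sumr_ge0 => ? _); rewrite sqr_ge0.
(* 2 ^+ n comes from [quad_sum_le], m bounds the squared coefficients, n cancels the averaging in
   [sample_cov], and the diagonal has p entries. The two extra units keep the constant positive when
   m = 0 or p = 0. *)
exists ((2 ^+ n * m + 1) * n%:R *+ p.+1).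
  by rewrite pmulrn_lgt0// mulr_gt0 ?ltr0n// ltr_wpDl ?mulr_ge0 ?exprn_ge0.
move=> Sig /PDG_inv[A [W [A0 [pW W0] [_ ->]]]]; set N := invmx W.
have N0 v : 0 <= quad N v by rewrite quad_invmx // posdef_quad_ge0.
have Nf i j : fingraph.root B i != fingraph.root B j -> N i j = 0.
  apply: invmx_block (posdef_unitmx pW) _ _ _ => {}i {}j rij.
  apply: W0; first by apply: contraNneq rij => ->.
  apply: contraNN rij => Bij; rewrite root_connect ?connect1 //.
  exact: sym_connect_sym.
pose E r := label_proj R (fingraph.root B) r.
pose q s := quad N (A^T *m x s).
have q0 s : 0 <= q s by exact: N0.
have trq : \tr (A *m N *m A^T *m sample_cov x) = n%:R^-1 * \sum_s q s.
  rewrite /sample_cov -scalemxAr mxtraceZ mulmx_sumr raddf_sum /=.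
  congr (_ * _); apply: eq_bigr => s _.
  by rewrite mulmxA mxtrace_mulC mulmxA /q -quad_mul /mxtrace big_ord1.
(* The block r of A^T v sees only the coordinates of v in [Pa D (C r)]; there e_k agrees with a
   combination of the data, or with 0 if k lies outside. *)
have Eqk r k : E r *m (A^T *m delta_mx k 0) =
    \sum_s (if k \in Pa D (C r) then c r k s else 0) *: (E r *m (A^T *m x s)).
  have AP u j : fingraph.root B j = r -> u \notin Pa D (C r) -> A u j = 0.
    move=> jr; rewrite !inE negb_or => /andP[uC /bigcupP uP]; apply: A0.
      by apply: contraNneq uC => ->; rewrite jr.
    apply/negP => Duj; apply: uP; exists j; last by rewrite inE.
    by rewrite inE jr.
  apply/colP => j; rewrite summxE label_proj_mull -colE !mxE.
  under eq_bigr => s _ do rewrite mxE label_proj_mull mulrCA.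
  rewrite -mulr_sumr.
  have [jr|] := eqVneq (fingraph.root B j) r; last by rewrite !mul0r.
  rewrite !mul1r; have [kP|kP] := boolP (k \in Pa D (C r)); last first.
    by rewrite AP // big1 // => s _; rewrite mul0r.
  transitivity (\sum_u A u j * \sum_s c r k s * x s u 0); last first.
    under eq_bigr => u _ do rewrite mulr_sumr.
    rewrite exchange_big /=; apply: eq_bigr => s _; rewrite mxE mulr_sumr.
    by apply: eq_bigr => u _; rewrite mxE mulrCA.
  rewrite (bigD1 k) //= hc // eqxx mulr1 big1 ?addr0 // => u uk.
  have [uP|uP] := boolP (u \in Pa D (C r)); last by rewrite AP // mul0r.
  by rewrite hc // (negbTE uk) mulr0.
(* Split along the labels, bound each block by the data blocks, then reassemble the blocks of each
   sample. *)
have Kk k : (A *m N *m A^T) k k <= 2 ^+ n * m * \sum_s q s.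
  rewrite -quad_delta quad_mul (@quad_label_split _ _ _ (fingraph.root B)) //.
  apply: (@le_trans _ _ (\sum_r 2 ^+ n * \sum_s m * quad N (E r *m (A^T *m x s)))).
    apply: ler_sum => r _; rewrite Eqk; apply: le_trans (quad_sum_le _ N0) _.
    rewrite ler_pM2l ?exprn_gt0//; apply: ler_sum => s _; rewrite quadZ.
    apply: ler_wpM2r => //; case: ifP => _; [exact: cm|by rewrite expr0n].
  rewrite -mulr_sumr exchange_big/= -mulrA ler_pM2l ?exprn_gt0// mulr_sumr.
  apply: ler_sum => s _; rewrite -mulr_sumr /q.
  by rewrite (@quad_label_split _ _ _ (fingraph.root B) N (A^T *m x s)).
rewrite trq mulrnAl -mulrA (mulVKf _) ?pnatr_eq0 ?gtn_eqF//.
have Q0 : 0 <= \sum_s q s by exact: sumr_ge0.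
apply: (@le_trans _ _ (\sum_(k < p) (2 ^+ n * m * \sum_s q s))).
  exact: ler_sum.
rewrite sumr_const card_ord [leRHS]mulrSr -[leLHS]addr0 lerD //.
  by rewrite lerMn2r ler_wpM2r ?orbT // lerDl.
by rewrite mulr_ge0 // addr_ge0 // mulr_ge0 // exprn_ge0.
Qed.

Lemma lhat_finite_sample_cov n (x : 'I_n -> 'cV[R]_p) :
  symmetric B -> (0 < n)%N ->
  (forall v, rows_independent x (Pa D (bcomp B v))) ->
  lhat_finite D B (sample_cov x).
Proof.
move=> sB n0 xU; have [c c0 hc] := trace_le_trace_mul_sample_cov sB n0 xU.
have [M hM] := ln_pow_le_linear p c0.
(* The 0 serves the case det Sig <= 0, where [ln] takes its default value 0 and the trace term is
   nonnegative. *)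
exists (Num.max M 0) => Sig GS; have := hc _ GS.
have /PDG_inv[A [W [A0 [pW W0] [uS iS]]]] := GS; rewrite /loglik.
set K := invmx Sig; set k := \tr (K *m _) => tk.
have K0 v : 0 <= quad K v.
  by rewrite /K iS quad_mul quad_invmx // posdef_quad_ge0.
have sK : K^T = K.
  by rewrite /K iS !trmx_mul trmxK trmx_inv (proj1 pW) mulmxA.
have Kt i j := entry_le_trace i j sK K0.
have t0 : 0 <= \tr K by apply: sumr_ge0 => i _; rewrite -quad_delta.
have k0 : 0 <= k by rewrite -(pmulr_rge0 _ c0); apply: le_trans tk.
rewrite le_max; have [d0|d0] := leP (\det Sig) 0.
  by apply/orP; right; rewrite ln0 //; lra.
apply/orP; left; have dK : \det K = (\det Sig)^-1 by rewrite det_inv.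
rewrite -lnV ?posrE // -dK lerBlDr.
apply: (@le_trans _ _ (\tr K / c + M)); last first.
  by rewrite addrC lerD2l ler_pdivrMr // mulrC.
apply: le_trans (hM _ t0).
have Kt1 i j : `|K i j| <= \tr K + 1 by apply: le_trans (Kt i j) _; lra.
have dK0 : 0 < \det K by rewrite dK invr_gt0.
have := det_entries_le Kt1; rewrite gtr0_norm // => h.
by rewrite ler_ln // posrE // (lt_le_trans dK0).
Qed.

End BoundedLikelihood.

(** * Lebesgue null sets *)

Lemma leb_null_fin_cover (R : realType) (p : nat) (A : set 'cV[R]_p) :
  (0 < p)%N ->
  (forall eps : R, 0 < eps -> exists (J : finType) (a b : J -> 'cV[R]_p),
    [/\ forall j k, a j k 0 <= b j k 0,
        forall x, A x -> exists j, box (a j) (b j) x &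
        \sum_j box_vol (a j) (b j) < eps]) ->
  leb_null A.
Proof.
move=> p0 hA eps /hA[J [a [b [ab Aab vol]]]].
pose s := [seq (a j, b j) | j <- enum J].
pose q m := nth (0, 0) s m.
have qE m (m_lt : (m < size s)%N) : exists j, q m = (a j, b j).
  rewrite /q; have /mapP[j _ ->] := mem_nth (0, 0) m_lt; by exists j.
have qab m k : (q m).1 k 0 <= (q m).2 k 0.
  have [sm|/qE[j ->]] := leqP (size s) m; last exact: ab.
  by rewrite /q nth_default.
have vol0 m : (0 <= (box_vol (q m).1 (q m).2)%:E)%E.
  by rewrite lee_fin; apply: prodr_ge0 => k _; rewrite subr_ge0.
exists (fun m => (q m).1), (fun m => (q m).2); split => //.
  move=> x /Aab[j xj]; exists (index (a j, b j) s) => //=.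
  by rewrite /q nth_index // map_f ?mem_enum.
rewrite (@nneseries_split _ _ 0 (size s)) // add0n.
(* The finite cover is padded with the box from 0 to 0. Its volume is 0 since 0 < p; the empty
   product would be 1. *)
rewrite [X in (_ + X)%E]eseries0 ?adde0 => [|m sm _]; last first.
  rewrite /q nth_default //= /box_vol.
  case: p p0 {A hA a b ab Aab vol s q qE qab vol0 sm} => // p _.
  by rewrite big_ord_recl !mxE subrr mul0r.
rewrite -(big_nth (0, 0) xpredT (fun r => (box_vol r.1 r.2)%:E)) /s big_map.
by rewrite big_enum /= sumEFin lte_fin.
Qed.

(* The slab around the graph over each of the (2Nm)^(p-1) grid cells of side 1/m
   has height 2L/m; cells are indexed by all functions from coordinates to
   grid positions, with the dummy position in coordinate k forced to 0. *)
Lemma leb_null_graph (R : realType) (p : nat) (k : 'I_p) (c : 'I_p -> R) (N : nat) :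
  c k = 0 ->
  leb_null [set x : 'cV[R]_p | x k 0 = \sum_i c i * x i 0 /\
                               forall i, - N%:R <= x i 0 < N%:R].
Proof.
move=> ck; apply: leb_null_fin_cover; first exact: leq_ltn_trans (ltn_ord k).
move=> eps eps0.
pose L : R := \sum_i `|c i|; have L0 : 0 <= L by exact: sumr_ge0.
pose V : R := \prod_(i | i != k) (2 * N%:R).
have V0 : 0 <= V by apply: prodr_ge0 => i _; rewrite mulr_ge0.
have [m hm] : exists m : nat, 2 * L * V / eps < m.+1%:R.
  by exists (Num.truncn (2 * L * V / eps)); exact: truncnS_gt.
pose e : R := m.+1%:R^-1; have e0 : 0 < e by rewrite invr_gt0.
have e1 : m.+1%:R * e = 1 by rewrite mulfV.
pose g (j : nat) : R := j%:R * e - N%:R.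
pose n := (2 * N * m.+1)%N.
(* The spare index n stands for a degenerate cell of volume 0 and keeps the index type inhabited
   when n = 0. *)
pose J := {ffun 'I_p -> 'I_n.+1}.
pose y (j : J) : R := \sum_i c i * g (j i).
pose w (j : J) : R := if j k == ord0 then L * e else 0.
pose a (j : J) : 'cV[R]_p := \col_i (if i == k then y j - w j else g (j i)).
pose b (j : J) : 'cV[R]_p := \col_i (if i == k then y j + w j else
  if (j i < n)%N then g (j i).+1 else g (j i)).
have w0 j : 0 <= w j by rewrite /w; case: ifP => // _; rewrite mulr_ge0 // ltW.
have gS j : g j.+1 = g j + e by rewrite /g -natr1 mulrDl mul1r addrAC.
exists J, a, b; split.
- move=> j i; rewrite !mxE; case: ifP => _; first by have := w0 j; lra.
  by case: ifP => // _; rewrite gS; lra.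
- move=> x [xk xN].
  pose t i := Num.truncn ((x i 0 + N%:R) * m.+1%:R).
  have t0 i : 0 <= (x i 0 + N%:R) * m.+1%:R.
    by rewrite mulr_ge0 //; have /andP[] := xN i; lra.
  have tn i : (t i < n)%N.
    rewrite -(@ltr_nat R); have /andP[h _] := truncn_itv (t0 i).
    apply: le_lt_trans h _; rewrite /n natrM ltr_pM2r // natrM.
    by have /andP[] := xN i; lra.
  have gt i : g (t i) <= x i 0 <= g (t i).+1.
    have /andP[h1 h2] := truncn_itv (t0 i).
    rewrite /g; apply/andP; split.
      by rewrite lerBlDr ler_pdivrMr.
    by rewrite lerBrDr ler_pdivlMr // ltW.
  pose j : J := [ffun i => if i == k then ord0 else inord (t i)].
  have jt i : i != k -> j i = t i :> nat.
    by move=> ik; rewrite ffunE (negbTE ik) inordK // ltnS ltnW.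
  exists j => i; rewrite !mxE; case: eqVneq => [->|ik]; last by rewrite jt // tn.
  have wE : w j = L * e by rewrite /w ffunE eqxx.
  (* Each other coordinate is within e of its grid point, and coordinate k does not enter since c k
     = 0. *)
  suff : `|x k 0 - y j| <= L * e by rewrite ler_norml wE; lra.
  rewrite xk /y -sumrB; apply: le_trans (ler_norm_sum _ _ _) _.
  rewrite /L mulr_suml; apply: ler_sum => l _.
  have [->|lk] := eqVneq l k; first by rewrite ck !mul0r subrr normr0 mul0r.
  rewrite -mulrBr normrM ler_wpM2l // jt //; have := gt l; rewrite gS.
  by rewrite ler_norml; lra.
pose f (i : 'I_p) (j : 'I_n.+1) : R :=
  if i == k then (if j == ord0 then 2 * (L * e) else 0)
  else (if (j < n)%N then e else 0).
have volE j : box_vol (a j) (b j) = \prod_i f i (j i).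
  apply: eq_bigr => i _; rewrite !mxE /f; case: eqVneq => [->|ik].
    rewrite /w; case: ifP => _; lra.
  by case: ifP => _; rewrite ?gS; lra.
under eq_bigr do rewrite volE.
(* Box volumes are products over coordinates, so the sum over all index functions factors into one
   sum per coordinate. *)
rewrite -bigA_distr_bigA (bigD1 k) //=.
have -> : \sum_j f k j = 2 * (L * e).
  rewrite /f eqxx (bigD1 ord0) //= big1 ?addr0 // => j j0.
  by rewrite (negbTE j0).
have -> : \prod_(i | i != k) \sum_j f i j = V.
  apply: eq_bigr => i ik; rewrite /f (negbTE ik) big_ord_recr /= ltnn addr0.
  under eq_bigr => j _ do rewrite ltn_ord.
  rewrite sumr_const card_ord -[e *+ n]mulr_natr /n !natrM.
  rewrite -[RHS]mulr1 -[X in _ = _ * X]e1; ring.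
move: hm; rewrite ltr_pdivrMr // => hm.
have -> : 2 * (L * e) * V = (2 * L * V) / m.+1%:R by rewrite /e; ring.
by rewrite ltr_pdivrMr // [eps * _]mulrC.
Qed.

(** * Measurability of random vectors and probability of hyperplanes *)

Section MeasurableVectors.
Import numFieldNormedType.Exports.

Lemma random_vec_measurable (d : measure_display) (T : measurableType d)
    (R : realType) (p : nat) (X : T -> 'cV[R]_p) : random_vec X ->
  measurable_fun setT (X : T -> g_sigma_algebraType (@coord_sets R p)).
Proof.
move=> mX; apply: (@measurability _ _ T (g_sigma_algebraType (@coord_sets R p))
  setT X (@coord_sets R p)) => //.
move=> _ [_ [k [Y mY ->]] <-]; rewrite -comp_preimage.
exact: (mX k measurableT Y mY).
Qed.

Lemma measurable_coord (R : realType) (p : nat) (k : 'I_p) :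
  measurable_fun setT (fun v : g_sigma_algebraType (@coord_sets R p) => v k 0).
Proof.
by move=> _ Y mY; rewrite setTI; apply: sub_sigma_algebra; exists k, Y.
Qed.

Lemma measurable_det (d : measure_display) (T : measurableType d)
    (R : realType) (k : nat) (A : T -> 'M[R]_k) :
  (forall i j, measurable_fun setT (fun w => A w i j)) ->
  measurable_fun setT (fun w => \det (A w)).
Proof.
move=> mA; apply: measurable_sum => s; apply: measurable_funM => //.
by apply: measurable_prod.
Qed.

Lemma measurable_zero_set (d : measure_display) (T : measurableType d)
    (R : realType) (f : T -> R) :
  measurable_fun setT f -> measurable [set w | f w = 0].
Proof.
by move=> mf; rewrite -[X in measurable X]setTI; exact: (mf measurableT [set 0]).
Qed.

(** Solving for a coordinate k with h k nonzero turns the hyperplane into a graph, which is a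
    countable union of the bounded pieces covered by [leb_null_graph]. *)
Lemma hyperplane_prob0 (d : measure_display) (T : measurableType d)
    (R : realType) (P : probability T R) (p : nat) (X : T -> 'cV[R]_p)
    (h : 'cV[R]_p) : random_vec X -> abs_cont P X -> h != 0 ->
  P (X @^-1` [set x | \sum_i h i 0 * x i 0 = 0]) = 0%E.
Proof.
move=> rX aX h0; have mX := random_vec_measurable rX.
pose E := g_sigma_algebraType (@coord_sets R p).
have mS : measurable [set x : E | \sum_i h i 0 * x i 0 = 0].
  apply: measurable_zero_set; apply: measurable_sum => i.
  by apply: measurable_funM => //; exact: measurable_coord.
have [k hk] : exists k, h k 0 != 0.
  apply/existsP; apply: contraNT h0; rewrite negb_exists => /forallP h0.
  by apply/eqP/colP => i; rewrite mxE; apply/eqP; have := h0 i; rewrite negbK.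
pose c i := if i == k then 0 else - h i 0 / h k 0.
pose H (N : nat) := [set x : E | x k 0 = \sum_i c i * x i 0 /\
   forall i, - N%:R <= x i 0 < N%:R].
have cE (x : E) : (\sum_i h i 0 * x i 0 = 0) <-> x k 0 = \sum_i c i * x i 0.
  have sE : \sum_i c i * x i 0 = - (\sum_(i | i != k) h i 0 * x i 0) / h k 0.
    rewrite (bigD1 k) //= /c eqxx mul0r add0r -sumrN mulr_suml.
    by apply: eq_bigr => i /negbTE ->; ring.
  rewrite sE (bigD1 k) //=; set b := \sum_(_ | _) _.
  split => [/eqP|->]; last by rewrite mulrC mulfVK // addNr.
  by rewrite addr_eq0 => /eqP <-; rewrite mulrAC mulfV // mul1r.
have mH N : measurable (H N).
  rewrite /H (_ : [set x | _] = [set x : E | \sum_i h i 0 * x i 0 = 0] `&`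
    \bigcap_(i in [set: 'I_p]) [set x : E | - N%:R <= x i 0 < N%:R]).
    apply: measurableI => //; apply: fin_bigcap_measurable => // i _.
    rewrite -[X in measurable X]setTI.
    rewrite (_ : [set x : E | _] =
        (fun x : E => x i 0) @^-1` [set` `[- N%:R, N%:R[%R]).
      exact: (@measurable_coord R p i measurableT _ (measurable_itv _)).
    by apply/seteqP; split => x /=; rewrite in_itv.
  apply/seteqP; split => x /=.
    by move=> [/cE ? h1]; split => // i _; exact: h1.
  by move=> [/cE ? h1]; split => // i; exact: h1.
rewrite (_ : X @^-1` _ = \bigcup_N X @^-1` (H N)); last first.
  rewrite -preimage_bigcup; congr (_ @^-1` _); apply/seteqP; split => x /=.
    move=> /cE xk; pose N := Num.truncn (\sum_i `|x i 0|).
    exists N.+1 => //; split => // i.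
    have : `|x i 0| < N.+1%:R.
      apply: le_lt_trans (truncnS_gt _).
      by rewrite (bigD1 i) //= lerDl sumr_ge0.
    by rewrite ltr_norml => /andP[/ltW -> ->].
  by move=> [N _ [/cE]].
apply/negligibleP.
  apply: bigcup_measurable => N _; rewrite -[X in measurable X]setTI.
  exact: (mX measurableT _ (mH N)).
apply: negligible_bigcup => N; apply/negligibleP.
  by rewrite -[X in measurable X]setTI; exact: (mX measurableT _ (mH N)).
apply: aX; first exact: (mH N).
by apply: leb_null_graph; rewrite /c eqxx.
Qed.

Lemma indep_orthogonal_prob0 (d : measure_display) (T : measurableType d)
    (R : realType) (P : probability T R) (p : nat) (H X : T -> 'cV[R]_p) :
  random_vec H -> random_vec X -> abs_cont P X ->
  (forall A B, borel_vec A -> borel_vec B ->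
     P (H @^-1` A `&` X @^-1` B) = (P (H @^-1` A) * P (X @^-1` B))%E) ->
  P.-negligible [set w | H w <> 0 /\ \sum_i H w i 0 * X w i 0 = 0].
Proof.
move=> rH rX aX iHX.
have mH := random_vec_measurable rH; have mX := random_vec_measurable rX.
pose E := g_sigma_algebraType (@coord_sets R p).
pose H' : {mfun T >-> E} := mfun_Sub (mem_set mH).
pose X' : {mfun T >-> E} := mfun_Sub (mem_set mX).
have mHX : measurable_fun setT (fun w => (H w : E, X w : E)).
  exact: measurable_fun_pair.
pose HX : {mfun T >-> (E * E)%type} := mfun_Sub (mem_set mHX).
pose bad := [set z : E * E | z.1 != 0 :> 'cV[R]_p] `&`
            [set z : E * E | \sum_i z.1 i 0 * z.2 i 0 = 0].
have mc1 i : measurable_fun setT (fun z : E * E => z.1 i 0).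
  exact: (measurableT_comp (@measurable_coord R p i) measurable_fst).
have mc2 i : measurable_fun setT (fun z : E * E => z.2 i 0).
  exact: (measurableT_comp (@measurable_coord R p i) measurable_snd).
have mbad : measurable bad.
  apply: measurableI.
    rewrite (_ : [set z : E * E | _] =
        ~` \bigcap_(i in [set: 'I_p]) [set z : E * E | z.1 i 0 = 0]).
      apply: measurableC; apply: fin_bigcap_measurable => // i _.
      exact: measurable_zero_set.
    apply/seteqP; split => z /=.
      by move=> /eqP z0 zi; apply: z0; apply/colP => i; rewrite mxE; exact: zi.
    by move=> zi; apply/eqP => z0; apply: zi => i _ /=; rewrite z0 mxE.
  apply: measurable_zero_set; apply: measurable_sum => i.
  exact: measurable_funM.
have bad0 : P ((fun w => (H w : E, X w : E)) @^-1` bad) = 0%E.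
  (* Agreement on rectangles identifies the joint law of (H, X) with the product of the two laws. *)
  have <- : (distribution P H' \x distribution P X')%E bad =
      P ((fun w => (H w : E, X w : E)) @^-1` bad).
    apply: (@product_measure_unique _ _ _ _ _ (distribution P H')
      (distribution P X') (distribution P HX)) mbad => A B mA mB.
    exact: iHX.
  (* Fubini: the section of [bad] at h is empty for h = 0 and a hyperplane otherwise, so the
     integrand vanishes. *)
  rewrite /product_measure1; apply: integral0_eq => h _ /=.
  have [->|h0] := eqVneq h (0 : 'cV[R]_p).
    rewrite (_ : xsection _ _ = set0) ?measure0 //.
    by apply/seteqP; split => x //; rewrite /xsection /= inE /bad /= eqxx => -[].
  rewrite (_ : xsection _ _ = [set x : E | \sum_i h i 0 * x i 0 = 0]).
    exact: (hyperplane_prob0 rX aX h0).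
  by apply/seteqP; split => x; rewrite /xsection /= inE /bad /=; [case|].
exists ((fun w => (H w : E, X w : E)) @^-1` bad); split => //.
  by rewrite -[X in measurable X]setTI; exact: (mHX measurableT).
by move=> w /= [/eqP ? ?]; split.
Qed.

End MeasurableVectors.

(** * Independence of one sample from the others, and almost sure invertibility of minors *)

Section Independence.
Context (d : measure_display) (T : measurableType d) (R : realType).
Context (P : probability T R) (p n : nat) (X : 'I_n -> T -> 'cV[R]_p).
Import numFieldNormedType.Exports.

(** A pi-system generating the sigma-algebra of all samples except [X k]. *)
Definition other_events (k : 'I_n) : set (set T) :=
  [set F | exists2 A : 'I_n -> set 'cV[R]_p, (forall s, borel_vec (A s)) &
           F = \bigcap_(s in [set s | s != k]) (X s @^-1` A s)].

Hypotheses (rX : forall s, random_vec (X s)) (iX : mutually_indep P X).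

Let measurable_preX s A : borel_vec A -> measurable (X s @^-1` A).
Proof.
move=> mA; rewrite -[X in measurable X]setTI.
exact: (random_vec_measurable (rX s) measurableT mA).
Qed.

Lemma other_events_measurable k F : other_events k F -> measurable F.
Proof.
move=> [A mA ->]; apply: fin_bigcap_measurable; first exact: finite_finset.
move=> s _; exact: measurable_preX.
Qed.

Lemma other_events_setI k : setI_closed (other_events k).
Proof.
move=> _ _ [A1 m1 ->] [A2 m2 ->]; exists (fun s => A1 s `&` A2 s).
  move=> s.
  exact: (@measurableI _ (g_sigma_algebraType (@coord_sets R p)) _ _ (m1 s) (m2 s)).
by rewrite -bigcapI; apply: eq_bigcapr => s _.
Qed.

Lemma other_events_setT k : other_events k setT.
Proof.
exists (fun=> setT).
  by move=> s; exact: (@measurableT _ (g_sigma_algebraType (@coord_sets R p))).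
by apply/seteqP; split.
Qed.

Lemma indep_other_events k F B : <<s other_events k >> F -> borel_vec B ->
  P (F `&` X k @^-1` B) = (P F * P (X k @^-1` B))%E.
Proof.
move=> GF mB; set C := X k @^-1` B.
have mC : measurable C by exact: measurable_preX.
have bT : borel_vec (setT : set 'cV[R]_p).
  exact: (@measurableT _ (g_sigma_algebraType (@coord_sets R p))).
pose r : {nonneg R} := NngNum (fine_ge0 (measure_ge0 P C)).
have rE : (r%:num)%:E = P C by rewrite /= fineK // fin_num_measure.
(* Both sides are finite measures in F, a restriction and a multiple of P, so it is enough to
   compare them on the pi-system. *)
rewrite muleC -rE -[LHS]/(mrestr P mC F) -[RHS]/(mscale r P F).
apply: (g_sigma_algebra_measure_unique (other_events k) _ (fun=> setT)) => //.
- exact: other_events_measurable.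
- by move=> _; exact: other_events_setT.
- by rewrite bigcup_const.
- exact: other_events_setI.
- move=> _ [A mA ->].
  have prodE B' : borel_vec B' ->
      P (\bigcap_(s in [set s | s != k]) (X s @^-1` A s) `&` X k @^-1` B') =
      (P (X k @^-1` B') * \prod_(s < n | s != k) P (X s @^-1` A s))%E.
    move=> mB'; pose A' s := if s == k then B' else A s.
    have bA' s : borel_vec (A' s) by rewrite /A'; case: ifP.
    transitivity (\prod_(s < n) P (X s @^-1` A' s))%E; last first.
      rewrite (bigD1 k) //=; congr (P (_ @^-1` _) * _)%E; first by rewrite /A' eqxx.
      by apply: eq_bigr => s /negbTE sk; rewrite /A' sk.
    rewrite -(iX bA'); congr (P _); apply/seteqP; split => w /=.
      by move=> [wA wB] s _; rewrite /A' /=; case: eqVneq => [->//|sk]; exact: wA.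
    move=> wA; split; last by have := wA k Logic.I; rewrite /= /A' eqxx.
    by move=> s /= /negbTE sk; have := wA s Logic.I; rewrite /= /A' sk.
  (* Taking the whole space as k-th event evaluates the probability of the other events alone. *)
  have FE := prodE setT bT.
  rewrite preimage_setT setIT probability_setT mul1e in FE.
  transitivity (P C * P (\bigcap_(s in [set s | s != k]) (X s @^-1` A s)))%E.
    by rewrite FE; exact: prodE.
  by rewrite -rE.
- move=> _; rewrite -[X in (X < _)%E]/(P (setT `&` C)) setTI.
  by rewrite ltey_eq fin_num_measure.
Qed.

Lemma measurable_coord_other k s u : s != k ->
  measurable_fun setT (fun w : g_sigma_algebraType (other_events k) => X s w u 0).
Proof.
move=> sk _ Y mY; rewrite setTI; apply: sub_sigma_algebra.
exists (fun t => if t == s then [set v : 'cV[R]_p | Y (v u 0)] else setT).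
  move=> t; case: eqP => _.
    by apply: sub_sigma_algebra; exists u, Y.
  exact: (@measurableT _ (g_sigma_algebraType (@coord_sets R p))).
apply/seteqP; split => w /=.
  by move=> wY t _ /=; case: eqP => // ->.
by move=> /(_ s sk) /=; rewrite eqxx.
Qed.

Hypothesis aX : forall s, abs_cont P (X s).

(** [g] and [s] are defined on all of [nat] and injective only below k, so the induction keeps the
    same functions while k shrinks. *)
Lemma minor_negligible k (g : nat -> 'I_p) (s : nat -> 'I_n) :
  {in gtn k &, injective g} -> {in gtn k &, injective s} ->
  P.-negligible [set w | \det (\matrix_(i < k, j < k) X (s j) w (g i) 0) = 0].
Proof.
elim: k => [|k IH] gi si.
  rewrite (_ : [set w | _] = set0); first exact: negligible_set0.
  apply/seteqP; split => w //=; rewrite det_mx00 => /eqP; by rewrite oner_eq0.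
have kS i : i \in gtn k -> i \in gtn k.+1 by rewrite !inE => /leqW.
have gk : {in gtn k &, injective g}.
  by move=> i j ik jk; apply: gi; exact: kS.
have sk : {in gtn k &, injective s}.
  by move=> i j ik jk; apply: si; exact: kS.
pose M w := \matrix_(i < k.+1, j < k.+1) X (s j) w (g i) 0.
pose cf w i := cofactor (M w) i ord_max.
(* The cofactors of the last column are placed at the coordinates [g i], so that pairing with
   [X (s k)] is the Laplace expansion. By injectivity, coordinate [g k] holds the last cofactor
   alone, which is the smaller minor. *)
pose H w : 'cV[R]_p := \col_u \sum_(i < k.+1) (g i == u)%:R * cf w i.
have HX w : \sum_u H w u 0 * X (s k) w u 0 = \det (M w).
  rewrite (expand_det_col _ ord_max).
  under eq_bigr => u _ do rewrite mxE mulr_suml.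
  rewrite exchange_big /=; apply: eq_bigr => i _.
  rewrite (bigD1 (g i)) //= eqxx mul1r big1 ?addr0 => [|u ug]; last first.
    by rewrite eq_sym (negbTE ug) !mul0r.
  by rewrite mxE mulrC.
have Hk w : H w (g k) 0 = \det (\matrix_(i < k, j < k) X (s j) w (g i) 0).
  rewrite mxE (bigD1 ord_max) //= eqxx mul1r big1 ?addr0 => [|i ik]; last first.
    case: eqP => [/gi e|]; last by rewrite mul0r.
    by move: ik; rewrite -val_eqE /= e ?eqxx ?inE.
  rewrite /cf /cofactor addnn -signr_odd odd_double mul1r; congr (\det _).
  by apply/matrixP => i j; rewrite !mxE !lift_max.
(* These cofactors omit the last column, and by injectivity of [s] no remaining column uses sample
   [s k]. *)
have mH u : measurable_fun setT
    (fun w : g_sigma_algebraType (other_events (s k)) => H w u 0).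
  have -> : (fun w => H w u 0) = (fun w => \sum_(i < k.+1) (g i == u)%:R * cf w i).
    by apply/funext => w; rewrite mxE.
  apply: measurable_sum => i; apply: measurable_funM => //.
  apply: measurable_funM => //; apply: measurable_det => a b.
  under eq_fun do rewrite !mxE.
  apply: measurable_coord_other; apply/eqP => /si; rewrite lift_max !inE.
  by move=> e; have := ltn_ord b; rewrite {1}e ?ltnn // ltnS ltnW.
have GH A : borel_vec A -> <<s other_events (s k) >> (H @^-1` A).
  move=> mA; rewrite -[H @^-1` A]setTI.
  exact: (random_vec_measurable mH measurableT mA).
have rH : random_vec (H : T -> _).
  move=> u _ Y mY; have := mH u measurableT Y mY; rewrite /measurable /=.
  apply: smallest_sub; last exact: other_events_measurable.
  exact: sigma_algebra_measurable.
apply: (negligibleS _ (negligibleU (IH gk sk)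
  (indep_orthogonal_prob0 rH (rX (s k)) (aX (s k)) _))); last first.
  by move=> A B mA mB; apply: indep_other_events => //; exact: GH.
move=> w /= dM; have [d0|d0] := eqVneq (H w (g k) 0) 0.
  by left; rewrite -Hk.
right; split; last by rewrite HX.
by move=> H0; move: d0; rewrite H0 mxE eqxx.
Qed.

Lemma ae_rows_independent (U : {set 'I_p}) : (#|U| <= n)%N ->
  {ae P, forall w, rows_independent (fun s => X s w) U}.
Proof.
move=> Un; have [u0 u0U|U0] := pickP (mem U); last first.
  by apply: aeW => w k; have := U0 k; rewrite inE => /= ->.
have U0 : (0 < #|U|)%N by apply/card_gt0P; exists u0.
have n0 : (0 < n)%N by exact: leq_trans Un.
(* The first |U| samples give a square matrix; the default values are never reached below |U|, since
   |U| <= n. *)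
pose g i := nth u0 (enum U) i; pose s j : 'I_n := insubd (Ordinal n0) j.
have sE j : (j < #|U|)%N -> s j = j :> nat.
  by move=> jU; rewrite val_insubd (leq_trans jU Un).
apply: (@negligibleS _ _ _ P _ _ _ (@minor_negligible #|U| g s _ _)).
- move=> w /= nI; apply: contrapT => d0; apply: nI => k kU.
  set M := \matrix_(i, j) _ in d0; have uM : M \in unitmx.
    by rewrite unitmxE unitfE; apply/eqP.
  have gE u : u \in U -> exists i : 'I_#|U|, u = g i.
    move=> uU; have iU : (index u (enum U) < #|U|)%N.
      by rewrite cardE index_mem mem_enum.
    by exists (Ordinal iU); rewrite /g /= nth_index // mem_enum.
  have [i0 ki0] := gE k kU.
  pose c := invmx M *m delta_mx i0 0 : 'cV[R]_#|U|.
  (* Column i0 of the inverse gives the coefficients of the samples used; the other samples get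
     0. *)
  exists (fun t => \sum_(j < #|U|) (s j == t)%:R * c j 0) => u uU.
  have [i ui] := gE u uU.
  transitivity (\sum_(j < #|U|) c j 0 * X (s j) w u 0).
    under eq_bigr => t _ do rewrite mulr_suml.
    rewrite exchange_big /=; apply: eq_bigr => j _.
    rewrite (bigD1 (s j)) //= eqxx mul1r big1 ?addr0 // => t tj.
    by rewrite eq_sym (negbTE tj) !mul0r.
  have : (M *m c) i 0 = (i == i0)%:R by rewrite mulKVmx // mxE eqxx andbT.
  rewrite mxE; under eq_bigr => j _ do rewrite mxE mulrC -ui.
  move=> ->; congr (_%:R); congr nat_of_bool; rewrite ui ki0 /g.
  by rewrite nth_uniq ?enum_uniq -?cardE.
- move=> i j; rewrite !inE !cardE => iU jU /eqP.
  by rewrite nth_uniq ?enum_uniq // => /eqP.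
- by move=> i j; rewrite !inE => iU jU /(congr1 val) /=; rewrite !sE.
Qed.

End Independence.

Theorem theorem4 (R : realType) (d : measure_display) (T : measurableType d)
    (P : probability T R) (p : nat) (D B : rel 'I_p) (n : nat)
    (X : 'I_n -> T -> 'cV[R]_p) :
  mixed_graph D B ->
  iid_ac_sample P X ->
  (forall v : 'I_p, (#|Pa D (bcomp B v)| <= n)%N) ->
  {ae P, forall w, lhat_finite D B (sample_cov (fun s => X s w))}.
Proof.
move=> [_ [_ sB]] [rX [aX [_ iX]]] PaN.
(* Without vertices the size hypothesis says nothing about n, but the log-likelihood is constantly
   0. *)
have [p0|p0] := posnP p.
  apply: aeW => w; exists 0 => Sig _; rewrite /loglik.
  move: Sig {PaN aX iX rX sB}; subst p => Sig.
  by rewrite det_mx00 ln1 /mxtrace big_ord0 subr0 oppr0.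
have n0 : (0 < n)%N.
  apply: leq_trans (PaN (Ordinal p0)); apply/card_gt0P; exists (Ordinal p0).
  by rewrite !inE connect0.
have : {ae P, forall w, forall v,
    rows_independent (fun s => X s w) (Pa D (bcomp B v))}.
  (* There are finitely many vertices, so the exceptional null sets can be merged. *)
  by apply: filter_forall => v; exact: (ae_rows_independent rX iX aX).
by apply: filterS => w wU; exact: lhat_finite_sample_cov.
Qed.
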